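(* Let $T_3 \subseteq \mathbb{R}^3$ be the tetrahedron with vertices $(0,0,0)$, $(1,0,0)$, $(0,1,0)$ and $(0,0,1)$, and let $c_3 = (1/3, 1/3, 1/3)$ be the centroid of the facet $\{(x,y,z) : x, y, z \geq 0,\ x+y+z = 1\}$. Then $\mathbb{E} V_{T_3[3],c_3} < \mathbb{E} V_{T_3[3]}$.
   Context: For a tetrahedron $T$ and a point $x \in T$, $V_{T[3]}$ denotes the area (2-dimensional volume) of the triangle whose vertices are three independent random points uniformly distributed in $T$, and $V_{T[3],x}$ denotes the area of the triangle whose vertices are the fixed point $x$ and two independent random points uniformly distributed in $T$. *)

(* Defs.v *)
From HB Require Import structures.
From mathcomp Require Import all_boot all_order all_algebra.
From mathcomp Require Import all_classical all_reals all_analysis.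

Set Implicit Arguments.
Unset Strict Implicit.
Unset Printing Implicit Defensive.

Import Order.TTheory GRing.Theory Num.Theory.
Import numFieldNormedType.Exports.

Local Open Scope classical_set_scope.
Local Open Scope ring_scope.

(* Points of R^3 as triples ((x, y), z), with the product (Borel) sigma-algebra. *)
Notation R3 R := (R * R * R)%type (only parsing).

Section Geometry.
Context {R : realType}.
Implicit Types u v a b c : R3 R.

Definition tetrahedron (v : 'I_4 -> R3 R) : set (R3 R) :=
  [set x | exists l : 'I_4 -> R,
    [/\ forall i, 0 <= l i, \sum_i l i = 1
      & x = \sum_i (l i * (v i).1.1, l i * (v i).1.2, l i * (v i).2)]].

Definition cross u v : R3 R :=
  (u.1.2 * v.2 - u.2 * v.1.2,
   u.2 * v.1.1 - u.1.1 * v.2,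
   u.1.1 * v.1.2 - u.1.2 * v.1.1).

(* The norm of the library on products is the maximum norm. *)
Definition enorm u : R := Num.sqrt (u.1.1 ^+ 2 + u.1.2 ^+ 2 + u.2 ^+ 2).

Definition triangle_area a b c : R := enorm (cross (b - a) (c - a)) / 2.

Definition volume : set (R3 R) -> \bar R :=
  (lebesgue_measure \x lebesgue_measure \x lebesgue_measure)%E.

End Geometry.

Section RandomPoints.
Context {R : realType} {d : measure_display} {Omega : measurableType d}.
Context {P : probability Omega R}.

Definition uniform_on (T : set (R3 R)) (X : {RV P >-> R3 R}) : Prop :=
  forall A, measurable A ->
    distribution P X A = (volume (A `&` T) / volume T)%E.

Definition independent (I : finType) (X : I -> {RV P >-> R3 R}) : Prop :=
  forall (J : {set I}) (A : I -> set (R3 R)), (forall i, measurable (A i)) ->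
    P (\bigcap_(i in [set` J]) (X i @^-1` A i)) =
    (\prod_(i in J) P (X i @^-1` A i))%E.

End RandomPoints.

Definition T3 {R : realType} : set (R3 R) :=
  tetrahedron (fun i => nth 0 [:: (0, 0, 0); (1, 0, 0); (0, 1, 0); (0, 0, 1)] i).

Definition c3 {R : realType} : R3 R := (3^-1, 3^-1, 3^-1).

(* Main.v *)
(** Let w be the cross product of two edges of the triangle, so that the area is
    |w|/2.

    For the triangle with a vertex at c3, |w| <= (|w|^2/h + h)/2 with h = 27/250
    close to the root mean square of |w|; the expectation of |w|^2 is a
    polynomial in the second moments of the uniform law, and equals 7/600. So
    E|w| <= 0.10802.

    For three random vertices, w is affine in each vertex, hence |w| is convex in
    each vertex. Cut the tetrahedron by the grid of mesh 1/6 into 56 cells; by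
    Jensen's inequality on the cells, applied to one vertex at a time, E|w| is at
    least the weighted mean of |w| over triples of centroids of cells. This is a
    finite sum of square roots of integers, bounded below by 0.1081 with integer
    square roots. The measures and centroids of the cells follow by
    inclusion-exclusion from the Dirichlet integrals over the corners
    {p <= v, |v|_1 <= 1}, which are homothetic to the tetrahedron. *)

Require Import Defs.
From Stdlib Require Import ZArith.
From HB Require Import structures.
From mathcomp Require Import all_boot all_order all_algebra.
From mathcomp Require Import ring lra zify ssrZ.
From mathcomp Require Import all_classical all_reals all_analysis.
From mathcomp Require Import measurable_realfun.

Set Implicit Arguments.
Unset Strict Implicit.
Unset Printing Implicit Defensive.

Import Order.TTheory GRing.Theory Num.Theory.
Import numFieldNormedType.Exports.

Local Open Scope classical_set_scope.
Local Open Scope ring_scope.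

(** * Dirichlet integrals *)

Section BetaIntegral.
Context {R : realType}.
Local Notation mu := (@lebesgue_measure R).

Lemma continuous_beta (p s : R) a b :
  continuous (fun y : R => (y - p) ^+ a * (s - y) ^+ b).
Proof.
move=> y; apply: (@continuousM _ _ (fun y => (y - p) ^+ a)
  (fun y => (s - y) ^+ b)).
- apply: (@continuous_comp _ _ _ (fun y => y - p) (fun z => z ^+ a)).
    by apply: cvgB => //; exact: cvg_cst.
  exact: exprn_continuous.
- apply: (@continuous_comp _ _ _ (fun y => s - y) (fun z => z ^+ b)).
    by apply: cvgB => //; exact: cvg_cst.
  exact: exprn_continuous.
Qed.

Lemma integrable_beta (p s : R) a b :
  mu.-integrable `[p, s] (EFin \o (fun y => (y - p) ^+ a * (s - y) ^+ b)).
Proof.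
apply: continuous_compact_integrable; first exact: segment_compact.
exact/continuous_subspaceT/continuous_beta.
Qed.

(** Euler's beta integral, by induction on [a] for all [b] at once: since
    [y - p = (s - p) - (s - y)], the integral for [(a.+1, b)] is [s - p] times the one for [(a, b)]
    minus the one for [(a, b.+1)]. *)
Lemma Rintegral_beta (p s : R) a b : p <= s ->
  \int[mu]_(y in `[p, s]) ((y - p) ^+ a * (s - y) ^+ b) =
  a`!%:R * b`!%:R / (a + b).+1`!%:R * (s - p) ^+ (a + b).+1.
Proof.
(* The degenerate interval is set apart because the fundamental theorem of calculus is applied with
   [p < s]. *)
rewrite le_eqVlt => /predU1P[->|ps].
  by rewrite set_itv1 Rintegral_set1 subrr exprS mul0r mulr0.
elim: a b => [|a IH] b.
  pose F : R -> R := (- b.+1%:R^-1 : R) \*: ((cst s - id) ^+ b.+1).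
  have dF (y : R) : is_derive y 1 F ((y - p) ^+ 0 * (s - y) ^+ b).
    apply: is_derive_eq.
    rewrite expr0 /GRing.scale/= !fctE.
    have : b.+1%:R != 0 :> R by [].
    by move=> b0; field.
  have Fc (y : R) : {for y, continuous F}.
    by apply: differentiable_continuous; apply/derivable1_diffP; have [] := dF y.
  rewrite /Rintegral (@continuous_FTC2 _ _ F p s) //=.
  - have FE z : F z = - b.+1%:R^-1 * (s - z) ^+ b.+1 by rewrite /F !fctE.
    rewrite !FE subrr expr0n/= mulr0 add0n fact0 mul1r factS natrM.
    have : b.+1%:R != 0 :> R by [].
    have : b`!%:R != 0 :> R by rewrite pnatr_eq0 -lt0n fact_gt0.
    by move=> b0 b1; field; rewrite nat1r b0 b1.
  - exact/continuous_subspaceT/continuous_beta.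
  - split.
    + by move=> y _; have [] := dF y.
    + exact/cvg_at_right_filter/Fc.
    + exact/cvg_at_left_filter/Fc.
  - by move=> y _; rewrite derive1E; have [_ ->] := dF y.
under eq_Rintegral => y _.
  rewrite (_ : _ * _ = (s - p) * ((y - p) ^+ a * (s - y) ^+ b)
             - (y - p) ^+ a * (s - y) ^+ b.+1); last by rewrite !exprS; ring.
  over.
rewrite RintegralB //=; last 2 first.
- exact: (integrableZl _ (s - p) (integrable_beta p s a b)).
- exact: integrable_beta.
rewrite RintegralZl //=; last exact: integrable_beta.
rewrite !IH addnS addSn !factS !natrM !exprS.
have c0 : (a + b).+2%:R != 0 :> R by [].
have d0 : (a + b).+1`!%:R != 0 :> R by rewrite pnatr_eq0 -lt0n fact_gt0.
move: d0; rewrite factS natrM mulf_eq0 negb_or => /andP[d1 d0].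
by field; rewrite d0 -natrD nat1r d1 -natrD.
Qed.

Lemma integral_beta (p s : R) a b : p <= s ->
  (\int[mu]_(y in `[p, s]) ((y - p) ^+ a * (s - y) ^+ b)%:E =
  (a`!%:R * b`!%:R / (a + b).+1`!%:R * (s - p) ^+ (a + b).+1)%:E)%E.
Proof.
move=> ps; rewrite -Rintegral_beta// /Rintegral fineK//.
exact/integrable_fin_num/integrable_beta.
Qed.

End BetaIntegral.

Lemma measurable_fun_natr_bool d (T : measurableType d) (R : realType)
    (f : T -> bool) :
  measurable_fun setT f -> measurable_fun setT (fun x => (f x)%:R : R).
Proof.
move=> mf; rewrite (_ : (fun _ => _) = (fun x => if f x then 1 else 0)).
  exact: measurable_fun_ifT.
by apply/funext => x; case: (f x).
Qed.

Ltac measurability :=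
  lazymatch goal with
  | |- measurable_fun _ (fun _ => ?c) => exact: measurable_cst
  | |- measurable_fun _ (fun x => x) => exact: measurable_id
  | |- measurable_fun _ (fun x => (@?f x)%:R) =>
      apply: measurable_fun_natr_bool; measurability
  | |- measurable_fun _ (fun x => @?f x && @?g x) =>
      apply: measurable_and; measurability
  | |- measurable_fun _ (fun x => @?f x <= @?g x) =>
      apply: measurable_fun_ler; measurability
  | |- measurable_fun _ (fun x => @?f x * @?g x) =>
      apply: measurable_funM; measurability
  | |- measurable_fun _ (fun x => @?f x ^+ _) =>
      apply: measurable_funX; measurability
  | |- measurable_fun _ (fun x => @?f x - @?g x) =>
      apply: measurable_funB; measurability
  | |- measurable_fun _ (fun x => @?f x + @?g x) =>
      apply: measurable_funD; measurability
  | |- measurable_fun _ (fun x => - @?f x) =>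
      apply: measurable_funN; measurability
  | |- measurable_fun _ (fun x => (@?f x).1) =>
      apply: (measurableT_comp measurable_fst); measurability
  | |- measurable_fun _ (fun x => (@?f x).2) =>
      apply: (measurableT_comp measurable_snd); measurability
  | |- measurable_fun _ fst => exact: measurable_fst
  | |- measurable_fun _ snd => exact: measurable_snd
  end.

(** * Sigma-finiteness of product measures *)

Section ProductSigmaFinite.
Local Open Scope ereal_scope.
Context d1 d2 (T1 : measurableType d1) (T2 : measurableType d2) (R : realType).
Variable m1 : {sigma_finite_measure set T1 -> \bar R}.
Variable m2 : {sigma_finite_measure set T2 -> \bar R}.

(** Two nondecreasing exhaustions by sets of finite measure give rectangles of finite measure that
    exhaust the product. This makes a product measure usable as a factor in Tonelli's theorem. *)
Lemma sigma_finite_product : sigma_finite setT (m1 \x m2).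
Proof.
have /sigma_finiteP[F [FT ndF Ffin]] := sigma_finiteT m1.
have /sigma_finiteP[G [GT ndG Gfin]] := sigma_finiteT m2.
exists (fun n => F n `*` G n) => [|n].
  apply/esym; rewrite -subTset => -[x y] _.
  have [i _ Fix] : (\bigcup_i F i) x by rewrite -FT.
  have [j _ Gjy] : (\bigcup_i G i) y by rewrite -GT.
  exists (maxn i j) => //; split => /=.
  - exact: (subsetPset _ _ (ndF _ _ (leq_maxl i j))).
  - exact: (subsetPset _ _ (ndG _ _ (leq_maxr i j))).
have [mF Foo] := Ffin n; have [mG Goo] := Gfin n.
split; first exact: measurableX.
by rewrite product_measure1E// lte_mul_pinfty// ge0_fin_numE.
Qed.

Definition product_sigma_finite :
    {sigma_finite_measure set (T1 * T2)%type -> \bar R} :=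
  HB.pack (m1 \x m2)
    (Measure_isSigmaFinite.Build _ _ _ (m1 \x m2) sigma_finite_product).
End ProductSigmaFinite.

(** * Integrals of monomials over corners *)

Section DirichletIntegral.
Context {R : realType}.
Local Notation mu := (@lebesgue_measure R).

(* [R] and [measurableTypeR R] have the same measurable sets but carry
   different displays, so that the identity has to be used as a measurable map
   between them. *)
Local Notation mR := (measurableTypeR R).

Lemma measurable_id_mR1 : measurable_fun [set: mR] (id : mR -> R).
Proof. by move=> _ A mA; rewrite setTI. Qed.

Lemma measurable_id_mR2 :
  measurable_fun [set: mR * mR] (id : mR * mR -> R * R).
Proof.
apply/measurable_fun_pairP; split.
- exact: (measurableT_comp measurable_id_mR1 measurable_fst).
- exact: (measurableT_comp measurable_id_mR1 measurable_snd).
Qed.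

Lemma measurable_id_mR3 :
  measurable_fun [set: mR * mR * mR] (id : mR * mR * mR -> R3 R).
Proof.
apply/measurable_fun_pairP; split.
- exact: (measurableT_comp measurable_id_mR2 measurable_fst).
- exact: (measurableT_comp measurable_id_mR1 measurable_snd).
Qed.

(** As a function, [lebesgue3] is convertible to [volume]; the packed structures carry the
    sigma-finiteness. *)
Definition lebesgue2 := product_sigma_finite mu mu.
Definition lebesgue3 := product_sigma_finite lebesgue2 mu.

(** The value B(a + 1, b + 1) of Euler's beta function. *)
Definition dirichlet_cst (a b : nat) : R :=
  a`!%:R * b`!%:R / (a + b).+1`!%:R.

(** The interval enters through an indicator because in an iterated integral it may be empty. The
    indicator that remains on the right then bounds the next variable. *)
Lemma integral_truncated_beta (k p s : R) a b :
  (\int[mu]_y ([&& p <= y & y <= s]%:R *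
     (k * ((y - p) ^+ a * (s - y) ^+ b)))%:E =
   ((p <= s)%R%:R * (k * (dirichlet_cst a b * (s - p) ^+ (a + b).+1)))%:E)%E.
Proof.
transitivity (\int[mu]_(y in `[p, s]) (k * ((y - p) ^+ a * (s - y) ^+ b))%:E)%E.
  rewrite [RHS]integral_mkcond; apply: eq_integral => y _.
  rewrite patchE mem_setE in_itv/=.
  by case: ifP => _; rewrite ?mul1r ?mul0r.
have [ps|sp] := leP p s; last first.
  by rewrite mul0r set_itv_ge ?integral_set0// bnd_simp -ltNge.
under eq_integral do rewrite EFinM.
rewrite (integralZl _ (@integrable_beta _ p s a b))//.
by rewrite integral_beta// mul1r EFinM.
Qed.

Definition corner (p v : R3 R) : bool :=
  [&& p.1.1 <= v.1.1, p.1.2 <= v.1.2, p.2 <= v.2 & v.1.1 + v.1.2 + v.2 <= 1].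

Definition corner_monomial (p : R3 R) (a b c : nat) (v : R3 R) : R :=
  (corner p v)%:R *
  ((v.1.1 - p.1.1) ^+ a * ((v.1.2 - p.1.2) ^+ b * (v.2 - p.2) ^+ c)).

Lemma measurable_corner_monomial p a b c :
  measurable_fun setT (corner_monomial p a b c).
Proof. by rewrite /corner_monomial /corner; measurability. Qed.

Lemma corner_monomial_ge0 p a b c v : 0 <= corner_monomial p a b c v.
Proof.
rewrite /corner_monomial /corner; case: and4P => [[px py pz _]|_]; last first.
  by rewrite mul0r.
by rewrite mul1r !mulr_ge0// exprn_ge0// subr_ge0.
Qed.

(** The corner at [p] is the translate by [p] of the tetrahedron scaled by this number, and is empty
    when the number is negative. *)
Definition corner_size (p : R3 R) : R := 1 - (p.1.1 + p.1.2 + p.2).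

(** Integrating over the third coordinate, then the second, then the first, gives a truncated beta
    integral each time. *)
Lemma integral_corner_monomial p a b c :
  (\int[lebesgue3]_v (corner_monomial p a b c v)%:E =
   ((0 <= corner_size p)%R%:R *
     (a`!%:R * b`!%:R * c`!%:R / (a + b + c).+3`!%:R
      * corner_size p ^+ (a + b + c).+3))%:E)%E.
Proof.
case: p => [[p1 p2] p3].
(* The integral over the third coordinate z, already in the shape of a truncated beta integrand in
   y: the condition [p3 <= 1 - x - y] has become the upper limit [1 - p3 - x] of y. *)
pose f2 (v : R * R) : R :=
  [&& p2 <= v.2 & v.2 <= 1 - p3 - v.1]%:R *
  ((p1 <= v.1)%R%:R * ((v.1 - p1) ^+ a * dirichlet_cst c 0) *
   ((v.2 - p2) ^+ b * (1 - p3 - v.1 - v.2) ^+ c.+1)).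
have f2E v : (\int[mu]_z (corner_monomial ((p1, p2), p3) a b c (v, z))%:E
    = (f2 v)%:E)%E.
  rewrite -[RHS]/((_ * _)%:E).
  transitivity (\int[mu]_z ([&& p3 <= z & z <= 1 - v.1 - v.2]%:R *
    (([&& p1 <= v.1 & p2 <= v.2])%:R * ((v.1 - p1) ^+ a * (v.2 - p2) ^+ b) *
    ((z - p3) ^+ c * (1 - v.1 - v.2 - z) ^+ 0)))%:E)%E.
    apply: eq_integral => z _; congr EFin.
    rewrite /corner_monomial /corner/= expr0 mulr1.
    rewrite (_ : (v.1 + v.2 + z <= 1) = (z <= 1 - v.1 - v.2)); last first.
      by rewrite -subr_ge0 -[RHS]subr_ge0; congr (_ <= _); ring.
    case: (p1 <= v.1) (p2 <= v.2) (p3 <= z) (z <= _) => [] [] [] []/=;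
    rewrite ?mul0r ?mulr0 ?mul1r ?mulr1 ?mul0r//; ring.
  rewrite integral_truncated_beta /f2 addn0; congr EFin.
  rewrite (_ : (v.2 <= 1 - p3 - v.1) = (p3 <= 1 - v.1 - v.2)); last first.
    by rewrite -subr_ge0 -[RHS]subr_ge0; congr (_ <= _); ring.
  rewrite (_ : 1 - p3 - v.1 - v.2 = 1 - v.1 - v.2 - p3); last by ring.
  case: (p1 <= v.1) (p2 <= v.2) (p3 <= _) => [] [] []/=;
    rewrite ?mul0r ?mulr0 ?mul1r ?mulr1 ?mul0r//; ring.
rewrite (@fubini_tonelli1 _ _ _ _ _ lebesgue2 mu
  (EFin \o corner_monomial ((p1, p2), p3) a b c)); last 2 first.
- apply/measurable_EFinP.
  exact: (measurableT_comp (measurable_corner_monomial _ _ _ _)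
            measurable_id_mR3).
- by move=> v; rewrite lee_fin corner_monomial_ge0.
under eq_integral do rewrite /fubini_F f2E.
rewrite (@fubini_tonelli1 _ _ _ _ _ mu mu (EFin \o f2)); last 2 first.
- have mf2 : measurable_fun [set: R * R] f2 by rewrite /f2; measurability.
  by apply/measurable_EFinP; exact: (measurableT_comp mf2 measurable_id_mR2).
- move=> v; change (0 <= (f2 v)%:E)%E; rewrite -f2E integral_ge0// => z _.
  by rewrite lee_fin corner_monomial_ge0.
rewrite /fubini_F.
transitivity (\int[mu]_x ([&& p1 <= x & x <= 1 - p3 - p2]%:R *
  (dirichlet_cst c 0 * dirichlet_cst b c.+1 *
   ((x - p1) ^+ a * (1 - p3 - p2 - x) ^+ (b + c).+2)))%:E)%E.
  apply: eq_integral => x _; rewrite /f2/= integral_truncated_beta; congr EFin.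
  rewrite (_ : (p2 <= 1 - p3 - x) = (x <= 1 - p3 - p2)); last first.
    by rewrite -subr_ge0 -[RHS]subr_ge0; congr (_ <= _); ring.
  rewrite (_ : 1 - p3 - x - p2 = 1 - p3 - p2 - x); last by ring.
  rewrite addnS.
  case: (p1 <= x) (x <= _) => [] []/=;
    rewrite ?mul0r ?mulr0 ?mul1r ?mulr1 ?mul0r//; ring.
rewrite integral_truncated_beta; congr EFin.
rewrite -subr_ge0 (_ : 1 - p3 - p2 - p1 = corner_size ((p1, p2), p3)); last first.
  by rewrite /corner_size/=; ring.
rewrite !addnS !addnA; congr (_ * _).
rewrite mulrA; congr (_ * _).
(* The product of the three beta constants telescopes: the factorials of c + 1 and b + c + 2
   cancel. *)
rewrite /dirichlet_cst addn0 fact0 mulr1 !addnS !addnA.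
have nz n : n`!%:R != 0 :> R by rewrite pnatr_eq0 -lt0n fact_gt0.
have h1 := nz c.+1; have h2 := nz (b + c).+2; have h3 := nz (a + b + c).+3.
by field; rewrite h1 h2 h3.
Qed.

End DirichletIntegral.

(** * The uniform law on the tetrahedron *)

Lemma R3_eq (R : realType) (u v : R3 R) :
  u.1.1 = v.1.1 -> u.1.2 = v.1.2 -> u.2 = v.2 -> u = v.
Proof. by move: u v => [[? ?] ?] [[? ?] ?] /= -> -> ->. Qed.

Lemma T3E (R : realType) : T3 = [set v : R3 R | corner (0, 0, 0) v].
Proof.
apply/seteqP; split=> [v [l [l0 l1 ->]]|[[x y] z]] /=.
  rewrite /corner /= !big_ord_recl !big_ord0 /= in l1 *.
  rewrite ?mulr0 ?mulr1 ?addr0 ?add0r.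
  have := l0 ord0; have := l0 (lift ord0 ord0).
  have := l0 (lift ord0 (lift ord0 ord0)).
  have := l0 (lift ord0 (lift ord0 (lift ord0 ord0))).
  rewrite ?addr0 in l1.
  by move=> h3 h2 h1 h0; apply/and4P; split => //; lra.
move=> /and4P[/= x0 y0 z0 xyz].
(* Barycentric coordinates: the weights of the three unit vertices are the Cartesian coordinates,
   and the origin takes the rest. *)
exists (fun i : 'I_4 => nth 0 [:: 1 - x - y - z; x; y; z] i); split.
- by move=> [[|[|[|[|]]]] //= _]; lra.
- by rewrite !big_ord_recl big_ord0 /=; ring.
- by apply: R3_eq; rewrite !big_ord_recl !big_ord0 /=; ring.
Qed.

(** The condition [uniform_on T3], put on the law itself, so that the estimates concern measures and
    not random variables. *)
Definition uniform_law (R : realType) (D : probability (R3 R) R) : Prop :=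
  forall A, measurable A -> D A = (volume (A `&` T3) / volume T3)%E.

Section UniformMean.
Context {R : realType} (D : probability (R3 R) R).

Definition has_mean (f : R3 R -> R) (m : R) : Prop :=
  D.-integrable setT (EFin \o f) /\ (\int[D]_v (f v)%:E = m%:E)%E.

Lemma has_mean_eq f g m : f =1 g -> has_mean f m -> has_mean g m.
Proof. by move=> /funext ->. Qed.

Lemma has_meanD f g m n :
  has_mean f m -> has_mean g n -> has_mean (fun v => f v + g v) (m + n).
Proof.
move=> [If Ef] [Ig Eg]; split; first exact: (integrableD _ If Ig).
rewrite EFinD -Ef -Eg -integralD//.
Qed.

Lemma has_meanZ f m k : has_mean f m -> has_mean (fun v => k * f v) (k * m).
Proof.
move=> [If Ef]; split; first exact: (integrableZl _ k If).
by rewrite EFinM -Ef -integralZl.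
Qed.

Lemma has_mean_sum (I : Type) (s : seq I) (f : I -> R3 R -> R) (m : I -> R) :
  (forall i, has_mean (f i) (m i)) ->
  has_mean (fun v => \sum_(i <- s) f i v) (\sum_(i <- s) m i).
Proof.
move=> fm; elim: s => [|i s IH].
  rewrite big_nil; apply: (@has_mean_eq (fun=> 0)) => [v|].
    by rewrite big_nil.
  by split; [exact: integrable0|rewrite integral0].
rewrite big_cons.
apply: (@has_mean_eq (fun v => f i v + \sum_(j <- s) f j v)) => [v|].
  by rewrite big_cons.
exact: has_meanD.
Qed.

Hypothesis uniformD : uniform_law D.

Lemma measurable_T3 : measurable (T3 : set (R3 R)).
Proof.
rewrite T3E; have mc : measurable_fun setT (corner (0, 0, 0) : R3 R -> bool).
  by rewrite /corner; measurability.
by rewrite -[X in measurable X]setTI; exact: (mc measurableT [set true]).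
Qed.

Lemma volume_T3 : volume (T3 : set (R3 R)) = (6^-1)%:E.
Proof.
rewrite -[volume]/(lebesgue3 : set _ -> _).
transitivity (\int[@lebesgue3 R]_v (corner_monomial (0, 0, 0) 0 0 0 v)%:E)%E.
  rewrite -[LHS]mul1e -integral_cst; last first.
    by have := measurable_id_mR3 measurableT measurable_T3; rewrite setTI.
  rewrite integral_mkcond; apply: eq_integral => v _.
  rewrite patchE /corner_monomial !expr0 !mulr1 T3E.
  rewrite (_ : (v \in _) = corner (0, 0, 0) v); last by rewrite mem_setE.
  by case: (corner _ v).
rewrite integral_corner_monomial/=; congr EFin.
rewrite /corner_size/= !addr0 subr0 ler01 expr1n !fact0 mul1r !mulr1 div1r.
by rewrite (_ : (_`! = 6)%N).
Qed.

(** [D] is Lebesgue measure restricted to the tetrahedron and multiplied by 6, the inverse of its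
    volume; the restriction does not affect [f], which vanishes outside. *)
Lemma integral_uniform (f : R3 R -> \bar R) :
  measurable_fun setT f -> (forall v, 0 <= f v)%E ->
  (forall v, ~ T3 v -> f v = 0)%E ->
  (\int[D]_v f v = 6%:E * \int[lebesgue3]_v f v)%E.
Proof.
move=> mf f0 fT.
have fTE : f \_ T3 = f.
  apply/funext => v; rewrite patchE; case: ifPn => // /negP.
  by rewrite inE => /fT.
(* Pushing forward along the identity moves Lebesgue measure to the display on which [D] lives. *)
pose V' : {measure set (R3 R) -> \bar R} := pushforward lebesgue3 (id :
  measurableTypeR R * measurableTypeR R * measurableTypeR R -> R3 R).
pose V := V' (@measurable_id_mR3 R).
have six_ge0 : 0 <= 6 :> R by [].
pose U := mscale (NngNum six_ge0) (mrestr V measurable_T3).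
have DU : (\int[D]_v f v = \int[U]_v f v)%E.
  apply: eq_measure_integral => A mA _.
  by rewrite [LHS]uniformD// volume_T3 inver invr_eq0 pnatr_eq0 invrK muleC.
have VT : (\int[mrestr V measurable_T3]_v f v = \int[V]_v f v)%E.
  rewrite -fTE -!integral_mkcond.
  by apply: eq_measure_integral => A mA AT; rewrite /= /mrestr setIidl.
have V3 := @ge0_integral_pushforward _ _ _ _ _ _ (@measurable_id_mR3 R)
  lebesgue3 setT f measurableT mf (fun v _ => f0 v).
rewrite DU.
rewrite [LHS](ge0_integral_mscale (mrestr V measurable_T3) measurableT
  (NngNum six_ge0) mf (fun v _ => f0 v)).
by rewrite VT; congr (_ * _)%E; exact: V3.
Qed.

(** Nonnegative coordinates of [p] place the corner inside the tetrahedron, so the uniform mean is 6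
    times the Dirichlet integral. *)
Lemma has_mean_corner_monomial (p : R3 R) (a b c : nat) :
  0 <= p.1.1 -> 0 <= p.1.2 -> 0 <= p.2 ->
  has_mean (corner_monomial p a b c) (6 * ((0 <= corner_size p)%R%:R *
     (a`!%:R * b`!%:R * c`!%:R / (a + b + c).+3`!%:R
      * corner_size p ^+ (a + b + c).+3))).
Proof.
move=> p1 p2 p3.
have mf : measurable_fun setT (EFin \o corner_monomial p a b c).
  by apply/measurable_EFinP; exact: measurable_corner_monomial.
rewrite /has_mean; set m := (X in _ = X%:E).
have E : (\int[D]_v (corner_monomial p a b c v)%:E = m%:E)%E.
  rewrite integral_uniform//.
  - by rewrite integral_corner_monomial -EFinM.
  - by move=> v; rewrite lee_fin corner_monomial_ge0.
  - move=> v; rewrite T3E /= => vT; rewrite /corner_monomial.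
    case: (boolP (corner p v)) => [/and4P[h1 h2 h3 h4]|_]; last by rewrite mul0r.
    case: vT; apply/and4P; split => //=.
    + exact: le_trans h1.
    + exact: le_trans h2.
    + exact: le_trans h3.
split=> //; apply/integrableP; split => //.
under eq_integral do rewrite gee0_abs ?lee_fin ?corner_monomial_ge0//.
by rewrite E ltry.
Qed.
End UniformMean.

(** * Grid cells *)

Section Cells.
Context {R : realType}.
Implicit Types (v g : R3 R) (i j k : nat).

(** Inclusion-exclusion over the eight vertices of a grid cube: applied to a quantity attached to
    the corners, it gives the same quantity for the cell. *)
Definition diff3 (F : nat -> nat -> nat -> R) i j k : R :=
  (F i j k - F i.+1 j k - (F i j.+1 k - F i.+1 j.+1 k)) -
  (F i j k.+1 - F i.+1 j k.+1 - (F i j.+1 k.+1 - F i.+1 j.+1 k.+1)).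

Definition grid i : R := i%:R / 6.

(** The indicator of a half-open interval, as a difference so that sums over [i] telescope. *)
Definition slab i (t : R) : R :=
  (grid i <= t)%R%:R - (grid i.+1 <= t)%R%:R.

Definition cell_indic i j k v : R :=
  (corner (0, 0, 0) v)%:R * (slab i v.1.1 * slab j v.1.2 * slab k v.2).

Definition grid_corner i j k : R3 R := (grid i, grid j, grid k).

Lemma grid_ge0 i : 0 <= grid i.
Proof. by rewrite divr_ge0. Qed.

(** Grid points have nonnegative coordinates, so their corners are cut from the tetrahedron by three
    independent inequalities. In this product form the cell identities below become ring
    identities. *)
Lemma corner_gridE i j k v : (corner (grid_corner i j k) v)%:R =
  (corner (0, 0, 0) v)%:R * ((grid i <= v.1.1)%R%:R * (grid j <= v.1.2)%R%:R
    * (grid k <= v.2)%R%:R) :> R.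
Proof.
have -> : corner (grid_corner i j k) v = [&& corner (0, 0, 0) v,
    grid i <= v.1.1, grid j <= v.1.2 & grid k <= v.2].
  apply/and4P/and4P => [[/= h1 h2 h3 h4]|[/and4P[_ _ _ h4] h1 h2 h3]]; split => //.
  apply/and4P; split => //=.
  - exact: le_trans (grid_ge0 _) h1.
  - exact: le_trans (grid_ge0 _) h2.
  - exact: le_trans (grid_ge0 _) h3.
by rewrite -!natrM !mulnb !andbA.
Qed.

Lemma cell_indicE i j k v : cell_indic i j k v =
  diff3 (fun i j k => corner_monomial (grid_corner i j k) 0 0 0 v) i j k.
Proof.
by rewrite /cell_indic /diff3 /corner_monomial !corner_gridE /slab; ring.
Qed.

(** In each of the eight terms the coordinate is split as its excess over the vertex of that corner
    plus the vertex coordinate, which varies with the term. *)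
Lemma cell_indicX i j k v : cell_indic i j k v * v.1.1 =
  diff3 (fun i j k => corner_monomial (grid_corner i j k) 1 0 0 v +
    grid i * corner_monomial (grid_corner i j k) 0 0 0 v) i j k.
Proof.
by rewrite /cell_indic /diff3 /corner_monomial !corner_gridE /slab/=; ring.
Qed.

Lemma cell_indicY i j k v : cell_indic i j k v * v.1.2 =
  diff3 (fun i j k => corner_monomial (grid_corner i j k) 0 1 0 v +
    grid j * corner_monomial (grid_corner i j k) 0 0 0 v) i j k.
Proof.
by rewrite /cell_indic /diff3 /corner_monomial !corner_gridE /slab/=; ring.
Qed.

Lemma cell_indicZ i j k v : cell_indic i j k v * v.2 =
  diff3 (fun i j k => corner_monomial (grid_corner i j k) 0 0 1 v +
    grid k * corner_monomial (grid_corner i j k) 0 0 0 v) i j k.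
Proof.
by rewrite /cell_indic /diff3 /corner_monomial !corner_gridE /slab/=; ring.
Qed.

Lemma slab_ge0 i t : 0 <= slab i t.
Proof.
rewrite subr_ge0 ler_nat; case: (leP (grid i.+1) t) => // it.
by rewrite (le_trans _ it)// ler_pM2r// ler_nat.
Qed.

Lemma sum_slab_le1 t : \sum_(i <- iota 0 6) slab i t <= 1.
Proof.
rewrite !big_cons big_nil /slab.
set a := ((grid 0 <= t)%R%:R : R).
have : a <= 1 by rewrite lern1 leq_b1.
have : 0 <= (grid 6 <= t)%R%:R :> R by [].
by lra.
Qed.

Lemma cell_indic_ge0 i j k v : 0 <= cell_indic i j k v.
Proof. by rewrite !mulr_ge0// slab_ge0. Qed.

End Cells.

(** * Probabilities and centroids of the cells *)

Section CellMeans.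
Context {R : realType} (D : probability (R3 R) R).
Hypothesis uniformD : uniform_law D.

Lemma has_meanB f g m n :
  has_mean D f m -> has_mean D g n -> has_mean D (fun v => f v - g v) (m - n).
Proof.
move=> fm /(has_meanZ (-1)) gn; rewrite -mulN1r.
by apply: has_mean_eq (has_meanD fm gn) => v; rewrite mulN1r.
Qed.

Lemma has_mean_diff3 (f : nat -> nat -> nat -> R3 R -> R) m i j k :
  (forall i j k, has_mean D (f i j k) (m i j k)) ->
  has_mean D (fun v => diff3 (fun i j k => f i j k v) i j k) (diff3 m i j k).
Proof. by move=> fm; rewrite /diff3; do ! apply: has_meanB. Qed.

(** The subtraction is truncated, so this is the positive part of the corner size. *)
Definition grid_size i j k : R := (6 - (i + j + k))%:R / 6.

Lemma corner_grid_size i j k n (rho := corner_size (grid_corner i j k) : R) :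
  (0 <= rho)%R%:R * rho ^+ n.+1 = grid_size i j k ^+ n.+1.
Proof.
have -> : rho = (6 - (i + j + k)%:R) / 6.
  by rewrite /rho /corner_size /grid_corner /grid /= !natrD; field.
rewrite /grid_size; have [le6|lt6] := leqP (i + j + k) 6.
  by rewrite natrB// divr_ge0 ?mul1r// subr_ge0 ler_nat.
rewrite (eqP (ltnW lt6 : (6 - (i + j + k) == 0)%N)) mul0r expr0n/=.
by rewrite pmulr_lge0 ?invr_gt0// subr_ge0 ler_nat leqNgt lt6 mul0r.
Qed.

Lemma has_mean_grid_corner i j k a b c :
  has_mean D (corner_monomial (grid_corner i j k) a b c)
    (6 * (a`!%:R * b`!%:R * c`!%:R / (a + b + c).+3`!%:R)
      * grid_size i j k ^+ (a + b + c).+3).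
Proof.
have := has_mean_corner_monomial uniformD a b c
  (grid_ge0 i : 0 <= (grid_corner i j k).1.1) (grid_ge0 j) (grid_ge0 k).
by rewrite [X in 6 * X]mulrCA corner_grid_size -!mulrA.
Qed.

(* The cube of side 1/6 with lower corner (i, j, k)/6 meets the tetrahedron in a
   corner tetrahedron, a cube minus a corner, or the full cube, according to
   whether m = 6 - (i + j + k) is 1, 2 or at least 3. Its volume in units of
   1/6^4 is [cell_volume m], and its centroid is the lower corner shifted by
   [cell_offset m / 20] of the side in each direction. *)
Definition cell_volume (m : nat) : nat :=
  match m with 0 => 0 | 1 => 1 | 2 => 5 | _ => 6 end.

Definition cell_offset (m : nat) : nat :=
  match m with 0 => 0 | 1 => 5 | 2 => 9 | _ => 10 end.

(** The probability of the cell: its volume, in units of 1/6^4, times the density 6. *)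
Definition cell_weight i j k : R := (cell_volume (6 - (i + j + k)))%:R / 216.

(** The centroid coordinate along the axis whose index is [l], namely (l + offset/20)/6; all
    centroids thus lie on the lattice of step 1/120. *)
Definition cell_coord i j k (l : nat) : R :=
  (20 * l + cell_offset (6 - (i + j + k)))%:R / 120.

(** A corner of size r has probability r^3. The third difference of cubes is constant once 6 - (i +
    j + k) is at least 3; below that, truncation makes 0, 1 and 2 separate cases. *)
Lemma diff3_volume i j k :
  diff3 (fun i j k => grid_size i j k ^+ 3) i j k = cell_weight i j k.
Proof.
rewrite /diff3 /grid_size /cell_weight !(addSn, addnS) !subnS.
case: (6 - _)%N => [|[|[|m]]] /=; by field.
Qed.

(** On a corner of size r the mean of the excess coordinate is r^4/4, since 6/4! = 1/4. *)
Lemma diff3_momentX i j k :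
  diff3 (fun i j k => grid_size i j k ^+ 4 / 4 + grid i * grid_size i j k ^+ 3)
    i j k = cell_weight i j k * cell_coord i j k i.
Proof.
rewrite /diff3 /grid_size /cell_weight /cell_coord !(addSn, addnS) !subnS.
rewrite /grid natrD natrM.
case: (6 - _)%N => [|[|[|m]]] /=; rewrite -!(natr1 i); by field.
Qed.

Lemma diff3_momentY i j k :
  diff3 (fun i j k => grid_size i j k ^+ 4 / 4 + grid j * grid_size i j k ^+ 3)
    i j k = cell_weight i j k * cell_coord i j k j.
Proof.
rewrite /diff3 /grid_size /cell_weight /cell_coord !(addSn, addnS) !subnS.
rewrite /grid natrD natrM.
case: (6 - _)%N => [|[|[|m]]] /=; rewrite -!(natr1 j); by field.
Qed.

Lemma diff3_momentZ i j k :
  diff3 (fun i j k => grid_size i j k ^+ 4 / 4 + grid k * grid_size i j k ^+ 3)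
    i j k = cell_weight i j k * cell_coord i j k k.
Proof.
rewrite /diff3 /grid_size /cell_weight /cell_coord !(addSn, addnS) !subnS.
rewrite /grid natrD natrM.
case: (6 - _)%N => [|[|[|m]]] /=; rewrite -!(natr1 k); by field.
Qed.

Lemma has_mean_cell i j k :
  has_mean D (cell_indic i j k) (cell_weight i j k).
Proof.
rewrite -diff3_volume.
apply: (has_mean_eq (fun v => esym (cell_indicE i j k v))).
apply: has_mean_diff3 => {}i {}j {}k.
have := has_mean_grid_corner i j k 0 0 0.
rewrite (_ : 6 * _ = 1); first by rewrite mul1r.
by rewrite !fact0 (_ : _.+3`! = 6)%N//; field.
Qed.

Lemma has_mean_cellX i j k :
  has_mean D (fun v => cell_indic i j k v * v.1.1)
    (cell_weight i j k * cell_coord i j k i).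
Proof.
rewrite -diff3_momentX.
apply: (has_mean_eq (fun v => esym (cell_indicX i j k v))).
apply: has_mean_diff3 => {}i {}j {}k; apply: has_meanD.
  have := has_mean_grid_corner i j k 1 0 0.
  rewrite (_ : 6 * _ = 4^-1); first by rewrite mulrC.
  by rewrite !fact0 (_ : 1`! = 1)%N // (_ : _.+3`! = 24)%N//; field.
apply: has_meanZ; have := has_mean_grid_corner i j k 0 0 0.
rewrite (_ : 6 * _ = 1); first by rewrite mul1r.
by rewrite !fact0 (_ : _.+3`! = 6)%N//; field.
Qed.

Lemma has_mean_cellY i j k :
  has_mean D (fun v => cell_indic i j k v * v.1.2)
    (cell_weight i j k * cell_coord i j k j).
Proof.
rewrite -diff3_momentY.
apply: (has_mean_eq (fun v => esym (cell_indicY i j k v))).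
apply: has_mean_diff3 => {}i {}j {}k; apply: has_meanD.
  have := has_mean_grid_corner i j k 0 1 0.
  rewrite (_ : 6 * _ = 4^-1); first by rewrite mulrC.
  by rewrite !fact0 (_ : 1`! = 1)%N // (_ : _.+3`! = 24)%N//; field.
apply: has_meanZ; have := has_mean_grid_corner i j k 0 0 0.
rewrite (_ : 6 * _ = 1); first by rewrite mul1r.
by rewrite !fact0 (_ : _.+3`! = 6)%N//; field.
Qed.

Lemma has_mean_cellZ i j k :
  has_mean D (fun v => cell_indic i j k v * v.2)
    (cell_weight i j k * cell_coord i j k k).
Proof.
rewrite -diff3_momentZ.
apply: (has_mean_eq (fun v => esym (cell_indicZ i j k v))).
apply: has_mean_diff3 => {}i {}j {}k; apply: has_meanD.
  have := has_mean_grid_corner i j k 0 0 1.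
  rewrite (_ : 6 * _ = 4^-1); first by rewrite mulrC.
  by rewrite !fact0 (_ : 1`! = 1)%N // (_ : _.+3`! = 24)%N//; field.
apply: has_meanZ; have := has_mean_grid_corner i j k 0 0 0.
rewrite (_ : 6 * _ = 1); first by rewrite mul1r.
by rewrite !fact0 (_ : _.+3`! = 6)%N//; field.
Qed.

End CellMeans.

(** * Jensen's inequality on the cells *)

(** The condition keeps the 56 cubes that meet the tetrahedron in positive volume. *)
Definition cells : seq (nat * nat * nat) :=
  [seq c <- [seq (ij, k) | ij <- [seq (i, j) | i <- iota 0 6, j <- iota 0 6],
                           k <- iota 0 6] | (c.1.1 + c.1.2 + c.2 < 6)%N].

Section Jensen.
Context {R : realType}.
Implicit Types (f : R3 R -> R) (c : nat * nat * nat).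

Definition dot (u v : R3 R) : R := u.1.1 * v.1.1 + u.1.2 * v.1.2 + u.2 * v.2.

(** Convexity in the form that Jensen's inequality uses: an affine minorant touching at each
    point. *)
Definition subdifferentiable f : Prop :=
  forall g, exists u, forall v, f g + dot u (v - g) <= f v.

Definition weight c : R := cell_weight c.1.1 c.1.2 c.2.

Definition centroid c : R3 R :=
  (cell_coord c.1.1 c.1.2 c.2 c.1.1, cell_coord c.1.1 c.1.2 c.2 c.1.2,
   cell_coord c.1.1 c.1.2 c.2 c.2).

Definition cell_mean f : R := \sum_(c <- cells) weight c * f (centroid c).

Lemma weight_ge0 c : 0 <= weight c.
Proof. by apply: divr_ge0; exact: ler0n. Qed.

Lemma cell_mean_ge0 f : (forall v, 0 <= f v) -> 0 <= cell_mean f.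
Proof.
by move=> f0; apply: sumr_ge0 => c _; rewrite mulr_ge0 ?weight_ge0.
Qed.

(** Subgradients at [g], chosen for each centroid, add up with the nonnegative weights to a
    subgradient of the mean. *)
Lemma subdifferentiable_cell_mean (f : R3 R -> R3 R -> R) :
  (forall w, subdifferentiable (f ^~ w)) ->
  subdifferentiable (fun v => cell_mean (f v)).
Proof.
move=> fs g; have /choice[u fu] := fun w => fs w g.
pose U (p : R3 R -> R) := \sum_(c <- cells) weight c * p (u (centroid c)).
exists (U (fun v => v.1.1), U (fun v => v.1.2), U (fun v => v.2)) => v.
rewrite /dot/= /U !mulr_suml -!big_split/=.
apply: ler_sum => c _.
have := fu (centroid c) v; rewrite /dot => /(ler_wpM2l (weight_ge0 c)).
by apply: le_trans; rewrite le_eqVlt; apply/orP; left; apply/eqP; ring.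
Qed.

(** Adding the discarded cubes can only increase the sum, which then factors into three telescoping
    sums of slabs. *)
Lemma sum_cell_indic_le1 v :
  \sum_(c <- cells) cell_indic c.1.1 c.1.2 c.2 v <= 1 :> R.
Proof.
apply: (@le_trans _ _ (\sum_(i <- iota 0 6) \sum_(j <- iota 0 6)
    \sum_(k <- iota 0 6) cell_indic i j k v)).
  rewrite /cells big_filter big_mkcond !big_allpairs.
  do 3 (apply: ler_sum => ? _).
  by case: ifP => // _; exact: cell_indic_ge0.
rewrite (_ : \sum_(i <- _) _ = (corner (0, 0, 0) v)%:R *
    ((\sum_(i <- iota 0 6) slab i v.1.1) * ((\sum_(j <- iota 0 6) slab j v.1.2)
    * (\sum_(k <- iota 0 6) slab k v.2)))); last first.
  rewrite [RHS]mulrC mulr_suml mulr_suml; apply: eq_bigr => i _.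
  rewrite mulr_suml mulr_sumr mulr_suml; apply: eq_bigr => j _.
  rewrite !mulr_sumr mulr_suml; apply: eq_bigr => k _.
  by rewrite /cell_indic; ring.
have slab01 (t : R) : 0 <= \sum_(i <- iota 0 6) slab i t <= 1.
  by rewrite sum_slab_le1 sumr_ge0// => i _; exact: slab_ge0.
have /andP[x0 x1] := slab01 v.1.1.
have /andP[y0 y1] := slab01 v.1.2.
have /andP[z0 z1] := slab01 v.2.
apply: mulr_ile1 => //; first by rewrite !mulr_ge0.
  by rewrite lern1 leq_b1.
by rewrite !mulr_ile1// mulr_ge0.
Qed.

Variable D : probability (R3 R) R.
Hypothesis uniformD : uniform_law D.

(** The integral of [h] is at most that of its positive part, which lies below [f]. Integrability of
    [f] is not assumed. *)
Lemma le_has_mean f m (h : R3 R -> R) : has_mean D h m ->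
  measurable_fun setT f -> (forall v, 0 <= f v) -> (forall v, h v <= f v) ->
  (m%:E <= \int[D]_v (f v)%:E)%E.
Proof.
move=> [Ih <-] mf f0 hf.
rewrite integralE; apply: (@le_trans _ _ (\int[D]_v (EFin \o h)^\+ v)%E).
  by rewrite -[leRHS]adde0 leeD2l// oppe_le0 integral_ge0.
apply: ge0_le_integral => //.
- by apply: measurable_funepos; exact: measurable_int Ih.
- exact/measurable_EFinP.
- by move=> v _; rewrite funeposE ge_max/= !lee_fin hf f0.
Qed.

(** On each cell [f] is bounded below by its affine minorant at the centroid, whose mean over the
    cell is the value at the centroid. The function [h] glues these minorants together. *)
Lemma cell_mean_le_integral f : measurable_fun setT f ->
  (forall v, 0 <= f v) -> subdifferentiable f ->
  ((cell_mean f)%:E <= \int[D]_v (f v)%:E)%E.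
Proof.
move=> mf f0 fs; have /choice[u fu] := fun c => fs (centroid c).
pose ph c v : R := cell_indic c.1.1 c.1.2 c.2 v.
pose h v := \sum_(c <- cells) (f (centroid c) * ph c v
  + ((u c).1.1 * (ph c v * v.1.1 - (centroid c).1.1 * ph c v)
   + ((u c).1.2 * (ph c v * v.1.2 - (centroid c).1.2 * ph c v)
   + (u c).2 * (ph c v * v.2 - (centroid c).2 * ph c v)))).
apply: (@le_has_mean _ _ h) => //.
  (* The mean of each summand of [h]; the linear terms cancel by the choice of the centroid. *)
  pose m c := f (centroid c) * weight c
    + ((u c).1.1 * (weight c * (centroid c).1.1 - (centroid c).1.1 * weight c)
     + ((u c).1.2 * (weight c * (centroid c).1.2 - (centroid c).1.2 * weight c)
     + (u c).2 * (weight c * (centroid c).2 - (centroid c).2 * weight c))).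
  rewrite (_ : cell_mean f = \sum_(c <- cells) m c); last first.
    by apply: eq_bigr => c _; rewrite /m; ring.
  apply: has_mean_sum => c.
  have H0 := has_mean_cell uniformD c.1.1 c.1.2 c.2.
  have HX := has_mean_cellX uniformD c.1.1 c.1.2 c.2.
  have HY := has_mean_cellY uniformD c.1.1 c.1.2 c.2.
  have HZ := has_mean_cellZ uniformD c.1.1 c.1.2 c.2.
  apply: has_meanD; first exact: has_meanZ.
  apply: has_meanD; first by apply: has_meanZ; apply: has_meanB => //; exact: has_meanZ.
  by apply: has_meanD; apply: has_meanZ; apply: has_meanB => //; exact: has_meanZ.
(* As [f] is nonnegative, it is enough that the cell indicators sum to at most 1. *)
move=> v; apply: (@le_trans _ _ ((\sum_(c <- cells) ph c v) * f v)).
  rewrite mulr_suml; apply: ler_sum => c _.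
  have := ler_wpM2l (cell_indic_ge0 c.1.1 c.1.2 c.2 v) (fu c v).
  by apply: le_trans; rewrite le_eqVlt; apply/orP; left; apply/eqP;
    rewrite /dot /ph/=; ring.
by rewrite -[leRHS]mul1r ler_wpM2r// sum_cell_indic_le1.
Qed.

End Jensen.

(** * The sum over triples of cells *)

Section IntegerBound.
Local Open Scope Z_scope.

Definition sumZ (T : Type) (s : seq T) (f : T -> Z) : Z :=
  foldr (fun x acc => f x + acc) 0 s.

Definition cross_sqZ (a b c : Z * Z * Z) : Z :=
  let: (a1, a2, a3) := a in let: (b1, b2, b3) := b in let: (c1, c2, c3) := c in
  let u1 := b1 - a1 in let u2 := b2 - a2 in let u3 := b3 - a3 in
  let v1 := c1 - a1 in let v2 := c2 - a2 in let v3 := c3 - a3 in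
  let w1 := u2 * v3 - u3 * v2 in
  let w2 := u3 * v1 - u1 * v3 in
  let w3 := u1 * v2 - u2 * v1 in
  w1 * w1 + w2 * w2 + w3 * w3.

(** Weight times 216 and centroid times 120, which are integers. *)
Definition cellZ (c : nat * nat * nat) : Z * (Z * Z * Z) :=
  let m := (6 - (c.1.1 + c.1.2 + c.2))%N in
  let coord l := Z.of_nat (20 * l + cell_offset m)%N in
  (Z.of_nat (cell_volume m), (coord c.1.1, coord c.1.2, coord c.2)).

Definition triple_sumZ : Z :=
  let s := map cellZ cells in
  sumZ s (fun a => a.1 * sumZ s (fun b => b.1 * sumZ s (fun c =>
    c.1 * Z.sqrt (cross_sqZ a.2 b.2 c.2)))).

(** Evaluated over all 56^3 triples. The bound, 157 times 10^8, is a product of small [Z.of_nat]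
    factors so that it passes to the reals without a large unary numeral. *)
Lemma triple_sumZ_ge : Z.le
  (Z.of_nat 157 * (Z.of_nat 100 * Z.of_nat 100 * (Z.of_nat 100 * Z.of_nat 100)))
  triple_sumZ.
Proof. by apply/Z.leb_le; vm_compute. Qed.
End IntegerBound.

(** * From the integer sum to the real bound *)

Section IntegerToReal.
Context {R : realType}.

Definition Z_to_real (z : Z) : R := (int_of_Z z)%:~R.

Lemma Z_to_realD x y : Z_to_real (Z.add x y) = Z_to_real x + Z_to_real y.
Proof. by rewrite /Z_to_real -[Z.add x y]/(x + y) !rmorphD. Qed.

Lemma Z_to_realM x y : Z_to_real (Z.mul x y) = Z_to_real x * Z_to_real y.
Proof. by rewrite /Z_to_real -[Z.mul x y]/(x * y) !rmorphM. Qed.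

Lemma Z_to_realB x y : Z_to_real (Z.sub x y) = Z_to_real x - Z_to_real y.
Proof. by rewrite /Z_to_real -[Z.sub x y]/(x - y) !rmorphB. Qed.

Lemma Z_to_real_nat n : Z_to_real (Z.of_nat n) = n%:R.
Proof. by rewrite /Z_to_real -[n in LHS]natn !rmorph_nat. Qed.

Lemma Z_to_real_le x y : Z.le x y -> Z_to_real x <= Z_to_real y.
Proof.
move=> xy; rewrite -subr_ge0 -Z_to_realB.
by rewrite -(Z2Nat.id (Z.sub y x)) ?Z_to_real_nat//; lia.
Qed.

Lemma Z_to_real_sqrt s : Z_to_real (Z.sqrt s) <= Num.sqrt (Z_to_real s).
Proof.
(* [Z.sqrt] is 0 on negative integers; otherwise it is the floor of the real root. *)
have [s0|s0] := Z.le_gt_cases 0 s; last first.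
  by rewrite Z.sqrt_neg ?sqrtr_ge0.
have [h _] := Z.sqrt_spec s s0.
rewrite -[leLHS]ger0_norm; last exact: (Z_to_real_le (Z.sqrt_nonneg s)).
by rewrite -sqrtr_sqr ler_wsqrtr// expr2 -Z_to_realM Z_to_real_le.
Qed.

Lemma Z_to_real_sum (T : Type) (s : seq T) (f : T -> Z) :
  Z_to_real (sumZ s f) = \sum_(x <- s) Z_to_real (f x).
Proof.
by elim: s => [|x s IH]; rewrite ?big_nil// big_cons Z_to_realD IH.
Qed.

Lemma triangle_area_centroid_ge a b c :
  Z_to_real (Z.sqrt (cross_sqZ (cellZ a).2 (cellZ b).2 (cellZ c).2))
    / (120 ^+ 2) / 2 <=
  triangle_area (centroid a) (centroid b) (centroid c).
Proof.
rewrite /triangle_area ler_wpM2r ?invr_ge0//.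
rewrite ler_pdivrMr ?exprn_gt0//.
have p0 : 0 <= (120 : R) ^+ 2 by rewrite exprn_ge0.
rewrite -[X in _ * X]ger0_norm// -sqrtr_sqr /enorm -sqrtrM; last first.
  by rewrite !addr_ge0 ?sqr_ge0.
apply: (le_trans (Z_to_real_sqrt _)).
rewrite le_eqVlt; apply/orP; left; apply/eqP; congr Num.sqrt.
rewrite /cross_sqZ/= !(Z_to_realD, Z_to_realM, Z_to_realB, Z_to_real_nat).
rewrite /centroid /cell_coord /cross/=.
by field.
Qed.

(** The denominator collects 216 for each of the three weights, 120^2 for the cross product, which
    is quadratic in the coordinates, and 2 for the area. The sums are peeled off one vertex at a
    time. *)
Lemma cell_mean3_ge :
  Z_to_real triple_sumZ / (216 ^+ 3 * 120 ^+ 2 * 2) <=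
  cell_mean (fun a => cell_mean (fun b => cell_mean (fun c =>
    triangle_area a b c : R))).
Proof.
have wE c : weight c = Z_to_real (cellZ c).1 / 216 :> R.
  by rewrite /weight /cell_weight Z_to_real_nat.
rewrite /triple_sumZ Z_to_real_sum big_map mulr_suml; apply: ler_sum => a _.
rewrite Z_to_realM Z_to_real_sum big_map wE.
rewrite [leLHS](_ : _ = Z_to_real (cellZ a).1 / 216 *
  (\sum_(j <- cells) Z_to_real ((cellZ j).1 *
    sumZ [seq cellZ i | i <- cells] (fun c => c.1 *
      Z.sqrt (cross_sqZ (cellZ a).2 (cellZ j).2 c.2)))%Z
     / (216 ^+ 2 * 120 ^+ 2 * 2))); last by rewrite -mulr_suml; field.
apply: ler_wpM2l; first by rewrite -wE weight_ge0.
apply: ler_sum => b _; rewrite Z_to_realM Z_to_real_sum big_map wE.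
rewrite [leLHS](_ : _ = Z_to_real (cellZ b).1 / 216 *
  (\sum_(j <- cells) Z_to_real ((cellZ j).1 *
      Z.sqrt (cross_sqZ (cellZ a).2 (cellZ b).2 (cellZ j).2))%Z
     / (216 * 120 ^+ 2 * 2))); last by rewrite -mulr_suml; field.
apply: ler_wpM2l; first by rewrite -wE weight_ge0.
apply: ler_sum => c _; rewrite Z_to_realM wE.
have := ler_wpM2l (weight_ge0 c : 0 <= weight c :> R)
  (triangle_area_centroid_ge a b c).
by rewrite wE; apply: le_trans; rewrite le_eqVlt; apply/orP; left; apply/eqP; field.
Qed.

(** The left side is the upper bound for the triangle at [c3], about 0.05401; the integer bound
    gives about 0.05409 on the right. *)
Lemma cell_mean3_gt : (7 / 600 / (27 / 250) + 27 / 250) / 4 <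
  cell_mean (fun a => cell_mean (fun b => cell_mean (fun c =>
    triangle_area a b c : R))).
Proof.
apply: lt_le_trans cell_mean3_ge.
have S_ge := Z_to_real_le triple_sumZ_ge.
have {S_ge} : 157 * (100 * 100 * (100 * 100)) <= Z_to_real triple_sumZ.
  by apply: le_trans S_ge; rewrite !Z_to_realM !Z_to_real_nat.
move: (Z_to_real triple_sumZ) => S S_ge.
rewrite ltr_pdivlMr; last by rewrite !mulr_gt0 ?exprn_gt0 ?ltr0n.
by apply: lt_le_trans S_ge; lra.
Qed.
End IntegerToReal.

(** * Joint laws of independent points *)

Section Independence.
Context {R : realType} {d : measure_display} {Omega : measurableType d}.
Context {P : probability Omega R}.
Local Open Scope ereal_scope.

Definition pairRV d1 d2 (T1 : measurableType d1) (T2 : measurableType d2)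
    (X : {mfun Omega >-> T1}) (Y : {mfun Omega >-> T2}) : Omega -> T1 * T2 :=
  fun w => (X w, Y w).

Lemma measurable_pairRV d1 d2 (T1 : measurableType d1) (T2 : measurableType d2)
    (X : {mfun Omega >-> T1}) (Y : {mfun Omega >-> T2}) :
  measurable_fun setT (pairRV X Y).
Proof. exact: measurable_fun_pair. Qed.

HB.instance Definition _ d1 d2 (T1 : measurableType d1)
    (T2 : measurableType d2) (X : {mfun Omega >-> T1}) (Y : {mfun Omega >-> T2}) :=
  isMeasurableFun.Build _ _ _ _ (pairRV X Y) (measurable_pairRV X Y).

(** By uniqueness of the product measure on rectangles, the joint law is the product of the laws;
    Tonelli's theorem then applies. *)
Lemma integral_independent_pair d1 d2 (T1 : measurableType d1)
    (T2 : measurableType d2) (X : {RV P >-> T1}) (Y : {RV P >-> T2})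
    (f : T1 * T2 -> \bar R) :
  (forall A B, measurable A -> measurable B ->
    P (X @^-1` A `&` Y @^-1` B) = P (X @^-1` A) * P (Y @^-1` B)) ->
  measurable_fun setT f -> (forall x, 0 <= f x) ->
  \int[P]_w f (X w, Y w) =
  \int[distribution P X]_x \int[distribution P Y]_y f (x, y).
Proof.
move=> XY mf f0.
transitivity (\int[distribution P (pairRV X Y)]_z f z).
  by rewrite ge0_integral_distribution.
transitivity (\int[distribution P X \x distribution P Y]_z f z).
  apply: eq_measure_integral => A mA _.
  by apply/esym/product_measure_unique => // {mA}A B mA mB; exact: XY.
exact: fubini_tonelli1.
Qed.

(** For fixed [C], both sides are finite measures in [E]. They agree on rectangles, which are stable
    under intersection and generate the product sigma-algebra. *)
Lemma pairRV_independent d1 d2 d3 (T1 : measurableType d1)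
    (T2 : measurableType d2) (U : measurableType d3)
    (X : {RV P >-> T1}) (Y : {RV P >-> T2}) (Z : {RV P >-> U}) :
  (forall A B C, measurable A -> measurable B -> measurable C ->
    P (X @^-1` A `&` Y @^-1` B `&` Z @^-1` C) =
    P (X @^-1` A `&` Y @^-1` B) * P (Z @^-1` C)) ->
  forall E C, measurable E -> measurable C ->
    P (pairRV X Y @^-1` E `&` Z @^-1` C) =
    P (pairRV X Y @^-1` E) * P (Z @^-1` C).
Proof.
move=> XYZ E C mE mC.
have mZC : measurable (Z @^-1` C) by exact: measurable_funPTI.
have PC : P (Z @^-1` C) \is a fin_num by exact: fin_num_measure.
have r0 : (0 <= fine (P (Z @^-1` C)))%R by exact: fine_ge0.
pose m0 : {measure set (T1 * T2)%type -> \bar R} :=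
  pushforward (mrestr P mZC) (pairRV X Y).
pose m1 := m0 (measurable_pairRV X Y).
pose m2 : {measure set (T1 * T2)%type -> \bar R} :=
  mscale (NngNum r0) (distribution P (pairRV X Y)).
suff : m1 E = m2 E.
  rewrite /m1 /m0 /m2 /= /mscale/= fineK// /pushforward /mrestr => ->.
  by rewrite muleC.
apply: (measure_unique [set A `*` B | A in @measurable _ T1 & B in @measurable _ T2]
  (fun=> setT)) => //.
- exact: measurable_prod_measurableType.
- move=> _ _ [A mA [B mB <-]] [A' mA' [B' mB' <-]].
  exists (A `&` A'); first exact: measurableI.
  by exists (B `&` B'); [exact: measurableI|rewrite setXI].
- by move=> _; exists setT => //; exists setT => //; rewrite setXTT.
- by rewrite bigcup_const//; exists 0%N.
- move=> _ [A mA [B mB <-]]; rewrite /m1 /m0 /m2 /= /mscale/= fineK//.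
  by rewrite /pushforward /mrestr muleC; exact: XYZ.
- move=> _; rewrite /m1 /m0/= /pushforward /mrestr.
  rewrite -ge0_fin_numE//; apply: fin_num_measure; apply: measurableI => //.
  by rewrite preimage_setT.
Qed.

(** The pair of the first two variables is treated as one variable independent of the third, and the
    pair is then split. *)
Lemma integral_independent_triple d1 d2 d3 (T1 : measurableType d1)
    (T2 : measurableType d2) (U : measurableType d3)
    (X : {RV P >-> T1}) (Y : {RV P >-> T2}) (Z : {RV P >-> U})
    (f : T1 * T2 * U -> \bar R) :
  (forall A B, measurable A -> measurable B ->
    P (X @^-1` A `&` Y @^-1` B) = P (X @^-1` A) * P (Y @^-1` B)) ->
  (forall A B C, measurable A -> measurable B -> measurable C ->
    P (X @^-1` A `&` Y @^-1` B `&` Z @^-1` C) =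
    P (X @^-1` A `&` Y @^-1` B) * P (Z @^-1` C)) ->
  measurable_fun setT f -> (forall x, 0 <= f x) ->
  \int[P]_w f (X w, Y w, Z w) =
  \int[distribution P X]_x \int[distribution P Y]_y
    \int[distribution P Z]_z f (x, y, z).
Proof.
move=> XY XYZ mf f0.
rewrite (@integral_independent_pair _ _ _ _ (pairRV X Y) Z f)//; last first.
  exact: pairRV_independent.
have mg : measurable_fun setT (fubini_F (distribution P Z) f).
  exact: measurable_fun_fubini_tonelli_F.
have g0 x : 0 <= fubini_F (distribution P Z) f x by exact: integral_ge0.
rewrite [LHS](ge0_integral_distribution (pairRV X Y) mg g0).
exact: (integral_independent_pair XY mg g0).
Qed.

Lemma independent_pair (I : finType) (X : I -> {RV P >-> R3 R}) i j :
  independent X -> i != j -> forall A B, measurable A -> measurable B ->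
  P (X i @^-1` A `&` X j @^-1` B) = P (X i @^-1` A) * P (X j @^-1` B).
Proof.
move=> indX ij A B mA mB; pose F k := if k == i then A else B.
have := indX [set i; j]%SET F.
rewrite big_setU1 ?inE//= big_set1 /F eqxx eq_sym (negbTE ij) => <-; last first.
  by move=> k; case: ifP.
congr (P _); apply/seteqP; split=> [w [wA wB] k /=|w XF].
  rewrite !inE => /orP[] /eqP ->; first by rewrite eqxx.
  by rewrite eq_sym (negbTE ij).
split; first by have := XF i; rewrite /= !inE eqxx; exact.
by have := XF j; rewrite /= !inE eqxx orbT eq_sym (negbTE ij); exact.
Qed.

Lemma independent_triple (I : finType) (X : I -> {RV P >-> R3 R}) i j k :
  independent X -> i != j -> i != k -> j != k ->
  forall A B C, measurable A -> measurable B -> measurable C ->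
  P (X i @^-1` A `&` X j @^-1` B `&` X k @^-1` C) =
  P (X i @^-1` A `&` X j @^-1` B) * P (X k @^-1` C).
Proof.
move=> indX ij ik jk A B C mA mB mC.
pose F l := if l == i then A else if l == j then B else C.
rewrite (independent_pair indX ij mA mB).
have := indX (i |: [set j; k])%SET F.
rewrite !big_setU1 ?inE ?negb_or ?ij ?ik//= big_set1 /F eqxx.
rewrite (eq_sym j i) (negbTE ij) eqxx (eq_sym k i) (negbTE ik).
rewrite (eq_sym k j) (negbTE jk) muleA => <-; last first.
  by move=> l; case: ifP => // _; case: ifP.
congr (P _); apply/seteqP; split=> [w [[wA wB] wC] l /=|w XF].
  rewrite !inE => /or3P[] /eqP ->; first by rewrite eqxx.
    by rewrite (eq_sym j i) (negbTE ij) eqxx.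
  by rewrite (eq_sym k i) (negbTE ik) (eq_sym k j) (negbTE jk).
split; first split.
- by have := XF i; rewrite /= !inE eqxx; exact.
- by have := XF j; rewrite /= !inE eqxx orbT (eq_sym j i) (negbTE ij); exact.
- have := XF k; rewrite /= !inE eqxx !orbT (eq_sym k i) (negbTE ik).
  by rewrite (eq_sym k j) (negbTE jk); exact.
Qed.

End Independence.

(** * Expected areas *)

Section TriangleArea.
Context {R : realType}.
Implicit Types (a b c u v w g q : R3 R).

Lemma enorm_ge0 w : 0 <= enorm w.
Proof. exact: sqrtr_ge0. Qed.

Lemma enorm_sqr w : enorm w ^+ 2 = dot w w.
Proof.
by rewrite /enorm sqr_sqrtr ?addr_ge0 ?sqr_ge0// /dot; ring.
Qed.

(** Cauchy-Schwarz, from Lagrange's identity: the defect of the squares is the squared norm of the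
    cross product. *)
Lemma dot_le_enorm u w : dot u w <= enorm u * enorm w.
Proof.
apply: (le_trans (ler_norm _)).
rewrite -sqrtr_sqr /enorm -sqrtrM ?addr_ge0 ?sqr_ge0// ler_wsqrtr//.
have h0 : 0 <= (u.1.1 * w.1.2 - u.1.2 * w.1.1) ^+ 2
  + (u.1.1 * w.2 - u.2 * w.1.1) ^+ 2 + (u.1.2 * w.2 - u.2 * w.1.2) ^+ 2.
  by rewrite !addr_ge0 ?sqr_ge0.
rewrite -subr_ge0; apply: (le_trans h0); rewrite le_eqVlt; apply/orP; left.
by apply/eqP; rewrite /dot; ring.
Qed.

(** The subgradient is the unit vector along [w], by Cauchy-Schwarz, and 0 when [w] vanishes. *)
Lemma enorm_subgradient w : exists u, forall w',
  enorm w + dot u (w' - w) <= enorm w'.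
Proof.
have [w0|w0] := eqVneq (enorm w) 0.
  exists (0, 0, 0) => w'; rewrite w0 /dot/= !mul0r !addr0.
  exact: enorm_ge0.
exists (w.1.1 / enorm w, w.1.2 / enorm w, w.2 / enorm w) => w'.
have wgt0 : 0 < enorm w by rewrite lt_neqAle eq_sym w0 enorm_ge0.
rewrite -(ler_pM2l wgt0); apply: le_trans (dot_le_enorm w w').
rewrite le_eqVlt; apply/orP; left; apply/eqP.
rewrite mulrDr -expr2 enorm_sqr /dot/=.
by field.
Qed.

(** A subgradient [u] of the norm is pulled back along the linear map v -> v x q, whose adjoint is u
    -> q x u by the symmetry of the triple product. *)
Lemma subdifferentiable_enorm (W : R3 R -> R3 R) q :
  (forall v g, W v - W g = cross (v - g) q) ->
  subdifferentiable (fun v => enorm (W v) / 2).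
Proof.
move=> Wq g; have [u hu] := enorm_subgradient (W g).
pose p := cross q u.
exists (p.1.1 / 2, p.1.2 / 2, p.2 / 2) => v.
have := hu (W v); rewrite Wq -(@ler_pM2r _ 2^-1)//.
apply: le_trans; rewrite le_eqVlt; apply/orP; left; apply/eqP.
by rewrite /dot /p /cross/=; ring.
Qed.

(** The cross product of the edges is affine in each vertex; [q] is the opposite edge with the
    appropriate orientation. *)
Lemma subdifferentiable_area1 b c :
  subdifferentiable (fun v => triangle_area v b c).
Proof.
apply: (@subdifferentiable_enorm _ (b - c)) => v g.
by apply: R3_eq; rewrite /cross/=; ring.
Qed.

Lemma subdifferentiable_area2 a c :
  subdifferentiable (fun v => triangle_area a v c).
Proof.
apply: (@subdifferentiable_enorm _ (c - a)) => v g.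
by apply: R3_eq; rewrite /cross/=; ring.
Qed.

Lemma subdifferentiable_area3 a b :
  subdifferentiable (fun v => triangle_area a b v).
Proof.
apply: (@subdifferentiable_enorm _ (a - b)) => v g.
by apply: R3_eq; rewrite /cross/=; ring.
Qed.

Lemma triangle_area_ge0 a b c : 0 <= triangle_area a b c.
Proof. by rewrite divr_ge0// enorm_ge0. Qed.

Lemma measurable_fun_enorm d (T : measurableType d) (f g h : T -> R) :
  measurable_fun setT f -> measurable_fun setT g -> measurable_fun setT h ->
  measurable_fun setT (fun t => enorm (f t, g t, h t)).
Proof.
move=> mf mg mh; rewrite /enorm/=.
apply: (@measurableT_comp _ _ _ _ _ _ (@Num.sqrt R)).
  by apply: continuous_measurable_fun; exact: sqrt_continuous.
by apply: measurable_funD; [apply: measurable_funD|]; exact: measurable_funX.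
Qed.

Lemma measurable_triangle_area :
  measurable_fun setT (fun v : R3 R * R3 R * R3 R =>
    triangle_area v.1.1 v.1.2 v.2).
Proof.
apply: measurable_funM; last exact: measurable_cst.
by rewrite /cross/=; apply: measurable_fun_enorm; measurability.
Qed.

Lemma measurable_triangle_area2 a :
  measurable_fun setT (fun v : R3 R * R3 R => triangle_area a v.1 v.2).
Proof.
apply: measurable_funM; last exact: measurable_cst.
by rewrite /cross/=; apply: measurable_fun_enorm; measurability.
Qed.

Lemma measurable_triangle_area3 a b :
  measurable_fun setT (fun v : R3 R => triangle_area a b v).
Proof.
apply: measurable_funM; last exact: measurable_cst.
by rewrite /cross/=; apply: measurable_fun_enorm; measurability.
Qed.

End TriangleArea.

Lemma measurable_integral (R : realType) d1 d2 (T1 : measurableType d1)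
    (T2 : measurableType d2) (D : probability T2 R) (f : T1 -> T2 -> \bar R) :
  measurable_fun setT (fun v => f v.1 v.2) -> (forall x y, 0 <= f x y)%E ->
  measurable_fun setT (fun x => \int[D]_y f x y)%E.
Proof.
move=> mf f0; exact: (measurable_fun_fubini_tonelli_F (fun v => f v.1 v.2) mf).
Qed.

(** * Bounds and moments under the uniform law *)

Section UniformExpectations.
Context {R : realType}.
Implicit Types (a b c v : R3 R).

(** Jensen's inequality turns the cell means into integrals from the outermost inwards. At each
    stage the means still inside preserve convexity in the vertex being treated. *)
Lemma cell_mean3_le_integral (D1 D2 D3 : probability (R3 R) R) :
  uniform_law D1 -> uniform_law D2 -> uniform_law D3 ->
  ((cell_mean (fun a => cell_mean (fun b => cell_mean (fun c =>
      triangle_area a b c))))%:E <=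
   \int[D1]_a \int[D2]_b \int[D3]_c (triangle_area a b c)%:E)%E.
Proof.
move=> U1 U2 U3.
have m1 := fun a b => measurable_triangle_area3 a b.
have mE2 a : measurable_fun setT (fun b => \int[D3]_c (triangle_area a b c)%:E)%E.
  apply: (@measurable_integral _ _ _ _ _ D3 (fun b c => (triangle_area a b c)%:E)).
    by apply/measurable_EFinP; exact: measurable_triangle_area2.
  by move=> *; rewrite lee_fin triangle_area_ge0.
have mE1 : measurable_fun setT
    (fun a => \int[D2]_b \int[D3]_c (triangle_area a b c)%:E)%E.
  refine (@measurable_integral _ _ _ _ _ D2
    (fun a b => \int[D3]_c (triangle_area a b c)%:E)%E _ _); last first.
    by move=> a b; apply: integral_ge0 => c _; rewrite lee_fin triangle_area_ge0.
  refine (@measurable_integral _ _ _ _ _ D3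
    (fun (v : R3 R * R3 R) c => (triangle_area v.1 v.2 c)%:E) _ _).
    by apply/measurable_EFinP; exact: measurable_triangle_area.
  by move=> *; rewrite lee_fin triangle_area_ge0.
have mean_ge0 := fun a b => cell_mean_ge0 (triangle_area_ge0 a b).
have mA1 b c : measurable_fun setT (fun v => triangle_area v b c).
  apply: measurable_funM; last exact: measurable_cst.
  by rewrite /cross/=; apply: measurable_fun_enorm; measurability.
have mA2 a c : measurable_fun setT (fun v => triangle_area a v c).
  apply: measurable_funM; last exact: measurable_cst.
  by rewrite /cross/=; apply: measurable_fun_enorm; measurability.
have mC f : (forall c, measurable_fun setT (f ^~ c)) ->
    measurable_fun setT (fun a => cell_mean (f a)).
  move=> mf; apply: measurable_sum => c.
  by apply: measurable_funM => //; exact: measurable_cst.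
have mM2 a : measurable_fun setT (fun b => cell_mean (triangle_area a b)).
  by apply: mC => c; exact: mA2.
have mM1 : measurable_fun setT
    (fun a => cell_mean (fun b => cell_mean (triangle_area a b))).
  by apply: (mC (fun a b => cell_mean (triangle_area a b))) => b; apply: mC.
apply: (@le_trans _ _
  (\int[D1]_a (cell_mean (fun b => cell_mean (triangle_area a b)))%:E)%E).
  apply: (cell_mean_le_integral U1) => //.
  - by move=> a; apply: cell_mean_ge0.
  - apply: (@subdifferentiable_cell_mean _
      (fun a b => cell_mean (triangle_area a b))) => b.
    apply: (@subdifferentiable_cell_mean _ (fun a => triangle_area a b)) => c.
    exact: subdifferentiable_area1.
apply: ge0_le_integral => //.
- by move=> a _; rewrite lee_fin; apply: cell_mean_ge0.
- exact/measurable_EFinP.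
move=> a _.
apply: (@le_trans _ _ (\int[D2]_b (cell_mean (triangle_area a b))%:E)%E).
  apply: (cell_mean_le_integral U2) => //.
  apply: subdifferentiable_cell_mean => c; exact: subdifferentiable_area2.
apply: ge0_le_integral => //.
- by move=> b _; rewrite lee_fin mean_ge0.
- exact/measurable_EFinP.
move=> b _; apply: (cell_mean_le_integral U3) => //.
- exact: triangle_area_ge0.
- exact: subdifferentiable_area3.
Qed.

Variable D : probability (R3 R) R.
Hypothesis uniformD : uniform_law D.

(** The complement of the tetrahedron has probability 0. With the indicator inserted, a polynomial
    becomes a combination of corner monomials. *)
Lemma integral_on_T3 (f : R3 R -> R) :
  measurable_fun setT f -> (forall v, 0 <= f v) ->
  (\int[D]_v (f v)%:E = \int[D]_v ((corner (0, 0, 0) v)%:R * f v)%:E)%E.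
Proof.
move=> mf f0.
have mT := measurable_T3 (R := R).
have DT : (D (~` T3) = 0)%E.
  rewrite [LHS]uniformD; last exact: measurableC.
  by rewrite setICl -[volume]/(lebesgue3 : set _ -> _) measure0 mul0e.
have mc : measurable_fun setT (fun v => (corner (0, 0, 0) v)%:R * f v).
  apply: measurable_funM => //.
  have := measurable_corner_monomial ((0, 0, 0) : R3 R) 0 0 0.
  by apply: eq_measurable_fun => v _; rewrite /corner_monomial !expr0 !mulr1.
rewrite (ge0_negligible_integral (measurableC mT) _ _ _ DT)//; last 2 first.
- exact/measurable_EFinP.
- by move=> v _; rewrite lee_fin.
rewrite [RHS](ge0_negligible_integral (measurableC mT) _ _ _ DT)//; last 2 first.
- exact/measurable_EFinP.
- by move=> v _; rewrite lee_fin mulr_ge0.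
apply: eq_integral => v; rewrite setDE setCK setTI inE T3E /= => ->.
by rewrite mul1r.
Qed.

(** The moments are 6/4! = 1/4 for a coordinate, 6 * 2!/5! = 1/10 for a square and 6/5! = 1/20 for a
    mixed product. *)
Lemma has_mean_quadratic (k kx ky kz kxx kyy kzz kxy kxz kyz : R) :
  has_mean D (fun v => (corner (0, 0, 0) v)%:R *
    (k + (kx * v.1.1 + ky * v.1.2 + kz * v.2)
     + (kxx * v.1.1 ^+ 2 + kyy * v.1.2 ^+ 2 + kzz * v.2 ^+ 2)
     + (kxy * (v.1.1 * v.1.2) + kxz * (v.1.1 * v.2) + kyz * (v.1.2 * v.2))))
    (k + (kx + ky + kz) / 4 + (kxx + kyy + kzz) / 10 + (kxy + kxz + kyz) / 20).
Proof.
have HM (i j l : nat) m :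
    6 * (i`!%:R * j`!%:R * l`!%:R / (i + j + l).+3`!%:R) = m ->
    has_mean D (corner_monomial (0, 0, 0) i j l) m.
  move=> <-; have := @has_mean_corner_monomial _ _ uniformD (0, 0, 0) i j l
    (lexx _) (lexx _) (lexx _).
  by rewrite /corner_size/= !addr0 subr0 ler01 expr1n mulr1 mul1r.
have [f1 f2] : (1`! = 1 /\ 2`! = 2)%N by [].
have [f3 f4 f5] : [/\ 3`! = 6, 4`! = 24 & 5`! = 120]%N by [].
have H0 : has_mean D (corner_monomial (0, 0, 0) 0 0 0) 1.
  by apply: HM; rewrite !fact0 addn0 f3; field.
have H1 i j l : (i + j + l = 1)%N ->
    has_mean D (corner_monomial (0, 0, 0) i j l) 4^-1.
  move=> h; apply: HM; rewrite h f4.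
  by case: i j l h => [|[|//]] [|[|//]] [|[|//]] // _; rewrite !fact0 f1; field.
have H2 i j l : (i + j + l = 2)%N -> 2%N \in [:: i; j; l] ->
    has_mean D (corner_monomial (0, 0, 0) i j l) 10^-1.
  move=> h m; apply: HM; rewrite h f5.
  by case: i j l h m => [|[|[|//]]] [|[|[|//]]] [|[|[|//]]] // _ _;
    rewrite !fact0 f2; field.
have H11 i j l : (i + j + l = 2)%N -> 2%N \notin [:: i; j; l] ->
    has_mean D (corner_monomial (0, 0, 0) i j l) 20^-1.
  move=> h m; apply: HM; rewrite h f5.
  by case: i j l h m => [|[|[|//]]] [|[|[|//]]] [|[|[|//]]] // _ _;
    rewrite !fact0 !f1; field.
have H := has_meanD (has_meanD (has_meanD (has_meanZ k H0)
  (has_meanD (has_meanD (has_meanZ kx (H1 1 0 0 erefl))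
    (has_meanZ ky (H1 0 1 0 erefl))) (has_meanZ kz (H1 0 0 1 erefl))))
  (has_meanD (has_meanD (has_meanZ kxx (H2 2 0 0 erefl erefl))
    (has_meanZ kyy (H2 0 2 0 erefl erefl))) (has_meanZ kzz (H2 0 0 2 erefl erefl))))
  (has_meanD (has_meanD (has_meanZ kxy (H11 1 1 0 erefl erefl))
    (has_meanZ kxz (H11 1 0 1 erefl erefl))) (has_meanZ kyz (H11 0 1 1 erefl erefl)))%N.
rewrite (_ : k + _ + _ + _ = k * 1 + (kx / 4 + ky / 4 + kz / 4) +
  (kxx / 10 + kyy / 10 + kzz / 10) + (kxy / 20 + kxz / 20 + kyz / 20)); last by ring.
by apply: has_mean_eq H => v; rewrite /corner_monomial/=; ring.
Qed.

(* With [b = v - c3], the covariances are [E b_i^2 = 2/45], [E b_i b_j = -1/180]. *)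
Lemma has_mean_centered_quadratic (k q1 q2 q3 q12 q13 q23 : R) :
  has_mean D (fun v => let b := v - c3 in (corner (0, 0, 0) v)%:R *
    (k + (q1 * b.1.1 ^+ 2 + q2 * b.1.2 ^+ 2 + q3 * b.2 ^+ 2)
     + (q12 * (b.1.1 * b.1.2) + q13 * (b.1.1 * b.2) + q23 * (b.1.2 * b.2))))
    (k + (q1 + q2 + q3) * (2 / 45) - (q12 + q13 + q23) / 180).
Proof.
pose k0 := k + (q1 + q2 + q3 + q12 + q13 + q23) / 9.
pose kx := - (2 * q1 + q12 + q13) / 3.
pose ky := - (2 * q2 + q12 + q23) / 3.
pose kz := - (2 * q3 + q13 + q23) / 3.
have := has_mean_quadratic k0 kx ky kz q1 q2 q3 q12 q13 q23.
rewrite (_ : k0 + _ + _ + _ = k + (q1 + q2 + q3) * (2 / 45)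
  - (q12 + q13 + q23) / 180); last by rewrite /k0 /kx /ky /kz; field.
by apply: has_mean_eq => v; rewrite /k0 /kx /ky /kz /c3/=; field.
Qed.

Lemma integral_centered_quadratic (k q1 q2 q3 q12 q13 q23 : R) (f : R3 R -> R) :
  measurable_fun setT f -> (forall v, 0 <= f v) ->
  (forall v, let b := v - c3 in f v =
    k + (q1 * b.1.1 ^+ 2 + q2 * b.1.2 ^+ 2 + q3 * b.2 ^+ 2)
     + (q12 * (b.1.1 * b.1.2) + q13 * (b.1.1 * b.2) + q23 * (b.1.2 * b.2))) ->
  (\int[D]_v (f v)%:E =
   (k + (q1 + q2 + q3) * (2 / 45) - (q12 + q13 + q23) / 180)%:E)%E.
Proof.
move=> mf f0 fE; rewrite integral_on_T3//.
have [_ <-] := has_mean_centered_quadratic k q1 q2 q3 q12 q13 q23.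
by apply: eq_integral => v _; rewrite fE.
Qed.

End UniformExpectations.

(** The area is dominated by [g], quadratic in each vertex, whose mean needs only the second moments
    about [c3]: that of |w|^2 is 3 (4/45)(2/45) - 3 (2/180)(1/180) = 7/600. *)
Lemma integral_area_c3_le (R : realType) (D1 D2 : probability (R3 R) R) :
  uniform_law D1 -> uniform_law D2 ->
  (\int[D1]_a \int[D2]_b (triangle_area c3 a b)%:E <=
   ((7 / 600 / (27 / 250) + 27 / 250) / 4)%:E)%E.
Proof.
move=> U1 U2; pose h : R := 27 / 250.
have hgt0 : 0 < h by rewrite /h; lra.
pose W a b : R3 R := cross (a - c3) (b - c3).
pose g a b : R := (dot (W a b) (W a b) / h + h) / 4.
have dot_ge0 u : 0 <= dot u u :> R by rewrite -enorm_sqr sqr_ge0.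
have g0 a b : 0 <= g a b.
  by rewrite divr_ge0// addr_ge0 ?(ltW hgt0)// divr_ge0 ?(ltW hgt0).
have area_le a b : triangle_area c3 a b <= g a b.
  rewrite /triangle_area -/(W a b) /g -enorm_sqr.
  have h4 : 0 < 4 * h by lra.
  rewrite -(ler_pM2r h4) -subr_ge0.
  (* After multiplication by 4h, the gap in the arithmetic-geometric mean inequality is a perfect
     square. *)
  rewrite (_ : _ - _ = (enorm (W a b) - h) ^+ 2) ?sqr_ge0//.
  by field; rewrite gt_eqF.
have mg a : measurable_fun setT (g a).
  by rewrite /g /dot /W /cross/=; measurability.
(* The mean of [g a] over the second vertex, again a quadratic in [a - c3], so that the same moment
   formula serves for the first vertex. *)
pose G a : R := h / 4 +
  (2 / 45 * 2 / (4 * h) * (a - c3).1.1 ^+ 2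
   + 2 / 45 * 2 / (4 * h) * (a - c3).1.2 ^+ 2
   + 2 / 45 * 2 / (4 * h) * (a - c3).2 ^+ 2)
  + ((2 / (4 * h) / 180) * ((a - c3).1.1 * (a - c3).1.2)
    + (2 / (4 * h) / 180) * ((a - c3).1.1 * (a - c3).2)
    + (2 / (4 * h) / 180) * ((a - c3).1.2 * (a - c3).2)).
have gG a : (\int[D2]_b (g a b)%:E = (G a)%:E)%E.
  pose p := a - c3.
  (* The coefficients are those of |p x q|^2 as a quadratic form in q = b - c3, divided by 4h. *)
  rewrite (integral_centered_quadratic (k := h / 4)
    (q1 := (p.1.2 ^+ 2 + p.2 ^+ 2) / (4 * h))
    (q2 := (p.1.1 ^+ 2 + p.2 ^+ 2) / (4 * h))
    (q3 := (p.1.1 ^+ 2 + p.1.2 ^+ 2) / (4 * h))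
    (q12 := - (2 * (p.1.1 * p.1.2)) / (4 * h))
    (q13 := - (2 * (p.1.1 * p.2)) / (4 * h))
    (q23 := - (2 * (p.1.2 * p.2)) / (4 * h)) U2 (mg a) (g0 a)).
    by congr EFin; rewrite /G -/p; field; rewrite gt_eqF.
  move=> b; rewrite /g /W -/p; move: (b - c3) => q /=.
  by rewrite /dot /cross/=; field; rewrite gt_eqF.
have G0 a : 0 <= G a.
  by rewrite -lee_fin -gG; apply: integral_ge0 => b _; rewrite lee_fin.
have mG : measurable_fun setT G by rewrite /G/=; measurability.
apply: (@le_trans _ _ (\int[D1]_a (G a)%:E)%E).
  apply: ge0_le_integral => //.
  - move=> a _; apply: integral_ge0 => b _; rewrite lee_fin.
    exact: triangle_area_ge0.
  - refine (@measurable_integral _ _ _ _ _ D2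
      (fun a b => (triangle_area c3 a b)%:E) _ _).
      by apply/measurable_EFinP; exact: measurable_triangle_area2.
    by move=> *; rewrite lee_fin triangle_area_ge0.
  - exact/measurable_EFinP.
  - move=> a _; rewrite -gG; apply: ge0_le_integral => //.
    + by move=> b _; rewrite lee_fin triangle_area_ge0.
    + by apply/measurable_EFinP; exact: measurable_triangle_area3.
    + by apply/measurable_EFinP; exact: mg.
    + by move=> b _; rewrite lee_fin area_le.
rewrite (integral_centered_quadratic U1 mG G0 (fun v => erefl)).
by rewrite lee_fin /h; lra.
Qed.

Theorem proposition2 (R : realType)
  (d : measure_display) (Omega : measurableType d) (P : probability Omega R)
  (X : 'I_3 -> {RV P >-> R3 R})
  (d' : measure_display) (Omega' : measurableType d') (Q : probability Omega' R)
  (Y : 'I_2 -> {RV Q >-> R3 R}) :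
  independent X -> (forall i, uniform_on T3 (X i)) ->
  independent Y -> (forall i, uniform_on T3 (Y i)) ->
  ('E_Q[fun w => triangle_area c3 (Y 0%R w) (Y 1%R w)] <
   'E_P[fun w => triangle_area (X 0%R w) (X 1%R w) (X 2%R w)])%E.
Proof.
move=> indX unifX indY unifY; rewrite unlock.
(* Independence turns both expectations into iterated integrals against the laws of the points. *)
have YE := integral_independent_pair
  (f := fun v => (triangle_area c3 v.1 v.2)%:E)
  (independent_pair indY (isT : (0 : 'I_2) != 1)).
have XE := integral_independent_triple
  (f := fun v => (triangle_area v.1.1 v.1.2 v.2)%:E)
  (independent_pair indX (isT : (0 : 'I_3) != 1))
  (independent_triple (i := 0) (j := 1) (k := 2) indX isT isT isT).
rewrite [ltLHS]YE; last 2 first.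
- by apply/measurable_EFinP; exact: measurable_triangle_area2.
- by move=> v; rewrite lee_fin triangle_area_ge0.
rewrite [ltRHS]XE; last 2 first.
- by apply/measurable_EFinP; exact: measurable_triangle_area.
- by move=> v; rewrite lee_fin triangle_area_ge0.
(* The two expectations are separated by the number (7/600/h + h)/4 with h = 27/250. *)
apply: (le_lt_trans (integral_area_c3_le (unifY _) (unifY _))).
apply: lt_le_trans (cell_mean3_le_integral (unifX _) (unifX _) (unifX _)).
by rewrite lte_fin cell_mean3_gt.
Qed.
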